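(* Let $\Omega=\{r<0\}\subset\mathbb{C}^n$ with $0\in b\Omega$, where $r(z_1,\dots,z_{n-1},w)=\operatorname{Im}w+F(z_1,\bar z_1,\dots,z_{n-1},\bar z_{n-1},\operatorname{Re}w,\operatorname{Im}w)$ and all terms of $F$ are of degree at least $2$. Suppose that $\rho=r\cdot h$ is a local plurisubharmonic defining function for $\Omega$ on the boundary near the origin, where $h$ is real-valued and does not vanish in a neighborhood of the origin. Then for each $j=1,\dots,n-1$, on $b\Omega$ in a neighborhood of the origin, $$\frac{\partial}{\partial z_j}\log h=-\frac{\partial}{\partial z_j}\log r_{\bar w}+E_j,$$ where $|E_j|^2\le C\left(\mathcal{L}_r(v_j)+|r_{z_j}|^2\right)$ for some constant $C>0$.
   Context: Coordinates on $\mathbb{C}^n$ are $(z_1,\dots,z_{n-1},w)$; subscripts denote partial derivatives. All functions are assumed smooth. A real-valued function $r$ is a defining function for $\Omega$ if $\Omega=\{r<0\}$ and $\nabla r\neq0$ on the boundary $b\Omega$. The normalization of $r$ guarantees $r_w\neq0$ near the origin. A local plurisubharmonic defining function on the boundary near $0$ is a real-valued function $\rho$, defined near $0$, such that for some neighborhood $V$ of $0$: $\Omega\cap V=\{\rho<0\}\cap V$, $\nabla\rho\neq0$ on $b\Omega\cap V$, and the complex Hessian matrix of $\rho$ is positive semidefinite (on all vectors of $\mathbb{C}^n$) at every point of $b\Omega\cap V$. For $j=1,\dots,n-1$, $v_j=\langle0,\dots,0,r_w,0,\dots,0,-r_{z_j}\rangle$ with $r_w$ in the $j$-th coordinate, and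 the Levi form on $v_j$ is $$\mathcal{L}_r(v_j)=r_{z_j\bar z_j}|r_w|^2+r_{w\bar w}|r_{z_j}|^2-2\operatorname{Re}[r_{z_j\bar w}r_wr_{\bar z_j}].$$ The logarithmic derivatives mean $\frac{\partial}{\partial z_j}\log h=h_{z_j}/h$ and $\frac{\partial}{\partial z_j}\log r_{\bar w}=r_{z_j\bar w}/r_{\bar w}$. *)

(* Defs.v *)
From HB Require Import structures.
From mathcomp Require Import all_boot all_order all_algebra.
From mathcomp Require Import all_classical all_reals all_analysis.
From mathcomp Require Import complex.

Set Implicit Arguments.
Unset Strict Implicit.
Unset Printing Implicit Defensive.

Import Order.TTheory GRing.Theory Num.Theory.
Import numFieldNormedType.Exports.

Local Open Scope classical_set_scope.
Local Open Scope ring_scope.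

(* R[i] as a normed module over itself, as is done for the abstract number
   fields in numFieldNormedType. *)
HB.instance Definition _ (R : realType) := GRing.ComAlgebra.copy R[i] R[i]^o.
HB.instance Definition _ (R : realType) := Vector.copy R[i] R[i]^o.
HB.instance Definition _ (R : realType) := NormedModule.copy R[i] R[i]^o.

(* C^(n+1) is 'rV[R[i]]_n.+1 with its max norm topology. The first n
   coordinates are z_1, ..., z_n, the last one is w. *)
Definition zidx n (j : 'I_n) : 'I_n.+1 := lift ord_max j.
Definition widx n : 'I_n.+1 := ord_max.

Section RealPartials.
Context {R : realType} {n : nat}.
Local Notation Cn := 'rV[R[i]]_n.+1.
Implicit Types (f : Cn -> R) (p v : Cn) (a : 'I_n.+1).

Definition slice v f p : R -> R := fun t => f (p + t%:C%C *: v).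

Definition pderivable v f p : Prop := derivable (slice v f p) 0 1.

Definition pd v f p : R := derive1 (slice v f p) 0.

(* With z_a = x_a + i y_a, pd (xdir a) and pd (ydir a) are the real partial
   derivatives with respect to x_a and y_a. *)
Definition xdir a : Cn := delta_mx 0 a.
Definition ydir a : Cn := 'i%C *: delta_mx 0 a.

(* C^k regularity; meaningful for open U, the only case used. *)
Fixpoint Ck_on (k : nat) (U : set Cn) f : Prop :=
  (forall p, U p -> {for p, continuous f}) /\
  (if k is k'.+1 then
     forall a v, v = xdir a \/ v = ydir a ->
       (forall p, U p -> pderivable v f p) /\ Ck_on k' U (pd v f)
   else True).

Definition smooth_on (U : set Cn) f : Prop := forall k, Ck_on k U f.

Definition smooth_near0 f : Prop :=
  exists U : set Cn, [/\ open U, U 0 & smooth_on U f].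

Definition gradient_neq0 f p : Prop :=
  exists a, pd (xdir a) f p != 0 \/ pd (ydir a) f p != 0.

(* The Taylor expansion of f at 0 has only terms of degree at least 2. *)
Definition order_ge2_at0 f : Prop :=
  f 0 = 0 /\ forall a, pd (xdir a) f 0 = 0 /\ pd (ydir a) f 0 = 0.

End RealPartials.

Section ComplexDerivatives.
Context {R : realType} {n : nat}.
Local Notation Cn := 'rV[R[i]]_n.+1.
Implicit Types (r f rho : Cn -> R) (g : Cn -> R[i]) (p : Cn) (a b : 'I_n.+1).

Definition cpd (v : Cn) g p : R[i] :=
  (pd v (fun q => complex.Re (g q)) p +i* pd v (fun q => complex.Im (g q)) p)%C.

(* The Wirtinger derivatives with respect to z_a and to its conjugate. *)
Definition dz a g p : R[i] := (cpd (xdir a) g p - 'i%C * cpd (ydir a) g p) / 2.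
Definition dzb a g p : R[i] := (cpd (xdir a) g p + 'i%C * cpd (ydir a) g p) / 2.

Definition toC f : Cn -> R[i] := fun p => (f p)%:C%C.

Definition complex_hessian f p : 'M[R[i]]_n.+1 :=
  \matrix_(a, b) dzb b (dz a (toC f)) p.

(* In the order of R[i], 0 <= x means that x is real and nonnegative. *)
Definition positive_semidefinite (H : 'M[R[i]]_n.+1) : Prop :=
  forall t : Cn, 0 <= \sum_a \sum_b H a b * t 0 a * Num.conj (t 0 b).

Definition boundary (A : set Cn) : set Cn := closure A `\` interior A.

Definition local_psh_defining_function_on_boundary (Omega : set Cn) rho : Prop :=
  exists V : set Cn,
    [/\ open V /\ V 0,
        smooth_on V rho,
        Omega `&` V = [set p | rho p < 0] `&` V,
        forall p, (boundary Omega `&` V) p -> gradient_neq0 rho p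
      & forall p, (boundary Omega `&` V) p ->
          positive_semidefinite (complex_hessian rho p)].

(* The Levi form of r on v_j = <0, ..., r_w, ..., 0, - r_{z_j}>, with r_w in
   position j. *)
Definition levi r (j : 'I_n) p : R[i] :=
  let z := zidx j in let w := widx n in
  dzb z (dz z (toC r)) p * `|dz w (toC r) p| ^+ 2
  + dzb w (dz w (toC r)) p * `|dz z (toC r) p| ^+ 2
  - 2 * 'Re (dzb w (dz z (toC r)) p * dz w (toC r) p * dzb z (toC r) p).

(* The derivative of log g with respect to z_a; no branch of log is needed. *)
Definition dzlog a g p : R[i] := dz a g p / g p.

End ComplexDerivatives.

(* Main.v *)
Require Import Defs.
From HB Require Import structures.
From mathcomp Require Import all_boot all_order all_algebra.
From mathcomp Require Import all_classical all_reals all_analysis.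
From mathcomp Require Import complex.
From mathcomp Require Import ring lra.

Set Implicit Arguments.
Unset Strict Implicit.
Unset Printing Implicit Defensive.

Import Order.TTheory GRing.Theory Num.Theory.
Import numFieldNormedType.Exports.

Local Open Scope classical_set_scope.
Local Open Scope ring_scope.

(** Write rho = r h. On the boundary r vanishes, so the product rule gives
    rho_{a b~} = h r_{a b~} + r_a h_{b~} + h_a r_{b~} for the complex Hessian,
    b~ being the conjugate variable; h is positive near 0 because rho and r are
    negative on the same set ([factor_gt0]).

    The vector v = v_j is annihilated by the differential of r, so rho_{a b~}
    evaluates on it to h L with L the Levi form, and the mixed value of the
    Hessian on v and the w-direction e is
      x = h r_w (r_{z w~} + h_z r_{w~} / h) - r_z K,
      K = h r_{w w~} + h_w r_{w~}.
    Positivity of the Hessian and the Cauchy-Schwarz inequality give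
    |x|^2 <= rho_{w w~} h L. Dividing by h |r_w|^2, the sum E of the logarithmic
    derivatives of h and r_{w~} is (x + r_z K) / (h |r_w|^2), whence
    |E|^2 <= C (L + |r_z|^2) as soon as rho_{w w~}, h and K are bounded and
    h |r_w|^2 is bounded below. Smoothness gives the former, and
    r_w (0) = - i / 2, h (0) > 0 the latter.

    The argument at a point is [conj_log_derivative_bound], in which the
    derivatives are just complex numbers. The second derivative occurring in
    the logarithmic derivative of r_{w~} is the conjugate of r_{w z~}; it equals
    the r_{z w~} of the Levi form because a positive semidefinite Hessian is
    Hermitian and h is not 0. The rest computes the Hessian of a product from
    the directional derivatives along real lines, and controls it near 0. *)

(** * Positive forms in two complex variables *)

Section PositiveForms.
Variable C : numClosedFieldType.
Implicit Types a b c d s t x : C.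

Definition psd2 a b c d := forall s t,
  0 <= a * (s * s^*) + b * (s * t^*) + c * (t * s^*) + d * (t * t^*).

Lemma psd2_eq a b c d a' b' c' d' :
  a = a' -> b = b' -> c = c' -> d = d' -> psd2 a b c d -> psd2 a' b' c' d'.
Proof. by move=> -> -> -> ->. Qed.

(** A Hermitian matrix is recovered from the reality of its form at (1, 1)
    and (1, i). *)
Lemma psd2_hermitian a b c d : psd2 a b c d -> [/\ 0 <= a, 0 <= d & c = b^*].
Proof.
move=> H.
have a0 : 0 <= a by have := H 1 0; rewrite rmorph1 rmorph0
  !(mulr0, mul0r, addr0, mulr1).
have d0 : 0 <= d by have := H 0 1; rewrite rmorph1 rmorph0
  !(mulr0, mul0r, addr0, add0r, mulr1).
split => //.
have aJ : a^* = a by apply: geC0_conj.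
have dJ : d^* = d by apply: geC0_conj.
have := geC0_conj (H 1 1); rewrite !rmorphD !rmorphM/= !rmorph1 aJ dJ !mulr1 => e1.
have := geC0_conj (H 1 'i).
rewrite !rmorphD !rmorphM/= !conjCK !rmorph1 !conjCi aJ dJ => e2.
have e3 : b + c = b^* + c^* by move/addIr : e1; rewrite -!addrA => /addrI ->.
have e4 : 'i * (c - b) = 'i * (b^* - c^*).
  have : a + 'i * (c - b) + d * ('i * - 'i) = a + 'i * (b^* - c^*) + d * ('i * - 'i).
    have -> : a + 'i * (b^* - c^*) + d * ('i * - 'i) =
        a * (1 * 1) + b^* * (1 * 'i) + c^* * (- 'i * 1) + d * (- 'i * 'i) by ring.
    by rewrite e2; ring.
  by move/addIr/addrI.
have {e4} e4 : c - b = b^* - c^* by apply: mulfI e4; rewrite neq0Ci.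
have : 2 * c = 2 * b^*.
  have -> : 2 * c = (b + c) + (c - b) by ring.
  by rewrite e3 e4; ring.
by apply: mulfI; rewrite pnatr_eq0.
Qed.

(** Cauchy-Schwarz for the vectors (s, t) and (0, 1), with an upper bound M of
    the diagonal entry in place of this entry. Taking M > 0 avoids treating
    the degenerate case d = 0 apart. *)
Lemma psd2_cauchy a b c d s t M : psd2 a b c d -> 0 < M -> d <= M ->
  `|b * s + d * t| ^+ 2 <=
    M * (a * (s * s^*) + b * (s * t^*) + c * (t * s^*) + d * (t * t^*)).
Proof.
move=> H M0 dM; set x := b * s + d * t.
have [a0 d0 cE] := psd2_hermitian H.
have dJ : d^* = d by apply: geC0_conj.
have MJ : M^* = M by apply/geC0_conj/ltW.
set Q := (X in _ <= M * X).
(* For M = d, the form makes M (s, t) - x (0, 1) orthogonal to (0, 1). *)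
have := H (M * s) (M * t - x).
have xJ : x^* = b^* * s^* + d * t^* by rewrite /x rmorphD !rmorphM/= dJ.
have -> : a * (M * s * (M * s)^*) + b * (M * s * (M * t - x)^*) +
   c * ((M * t - x) * (M * s)^*) + d * ((M * t - x) * (M * t - x)^*) =
   M * (M * Q - x * x^*) - (M - d) * (x * x^*).
  by rewrite !rmorphB !rmorphM/= MJ xJ /Q cE /x; ring.
rewrite subr_ge0 => h0.
have : 0 <= M * (M * Q - x * x^*).
  by apply: le_trans h0; rewrite mulr_ge0 ?mul_conjC_ge0// subr_ge0.
by rewrite pmulr_rge0// subr_ge0 normCK.
Qed.

(** The estimate at one boundary point. The letters stand for the values of
    h, r and their derivatives, m for the lower bound of h |r_w|^2; the entries
    of the form are the complex Hessian of r h where r vanishes. *)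
Lemma conj_log_derivative_bound
    (h rz rw hz hw rzz rzw rwz rww M H K m : C) :
  let Hww := h * rww + rw * hw^* + hw * rw^* in
  let L := rzz * `|rw| ^+ 2 + rww * `|rz| ^+ 2 - 2 * 'Re (rzw * rw * rz^*) in
  let E := hz / h + rwz^* / rw^* in
  0 < h -> h <= H -> 0 < M -> Hww <= M ->
  `|h * rww + hw * rw^*| <= K -> 0 < m -> m <= h * `|rw| ^+ 2 ->
  psd2 (h * rzz + rz * hz^* + hz * rz^*) (h * rzw + rz * hw^* + hz * rw^*)
       (h * rwz + rw * hz^* + hw * rz^*) Hww ->
  `|E| ^+ 2 <= 2 * (M * H + K ^+ 2) / m ^+ 2 * (L + `|rz| ^+ 2).
Proof.
move=> Hww L E h0 hH M0 HM KK m0 mh P.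
have [_ d0 cE] := psd2_hermitian P.
have hJ : h^* = h by apply/geC0_conj/ltW.
have hn0 : h != 0 by rewrite gt_eqF.
have rwn0 : rw != 0.
  apply/eqP => e; move: mh; rewrite e normr0 expr0n/= mulr0.
  by move/(lt_le_trans m0); rewrite ltxx.
(* The first-order terms of the Hessian of r h are Hermitian by themselves,
   so h times the Hessian of r is Hermitian too. *)
have rwz_eq : rwz^* = rzw.
  apply: (mulfI hn0).
  move: cE; rewrite !rmorphD !rmorphM/= !conjCK hJ => cE.
  have : h * rwz = h * rzw^*.
    have -> : h * rwz = h * rwz + rw * hz^* + hw * rz^* - (rw * hz^* + hw * rz^*) by ring.
    by rewrite cE; ring.
  by move/(mulfI hn0) => ->; rewrite conjCK.
have {}cE : rwz = rzw^* by rewrite -rwz_eq conjCK.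
(* The mixed value of the form on v = (rw, - rz) and (0, 1). *)
set x := (h * rzw + rz * hw^* + hz * rw^*) * rw + Hww * (- rz).
have hL : (h * rzz + rz * hz^* + hz * rz^*) * (rw * rw^*)
    + (h * rzw + rz * hw^* + hz * rw^*) * (rw * (- rz)^*)
    + (h * rwz + rw * hz^* + hw * rz^*) * (- rz * rw^*)
    + Hww * (- rz * (- rz)^*) = h * L.
  rewrite /L !normCK /Hww !rmorphN/= cE.
  have -> : 'Re (rzw * rw * rz^*) = (rzw * rw * rz^* + rzw^* * rw^* * rz) / 2.
    by rewrite ReE !rmorphM/= conjCK.
  by field.
have L0 : 0 <= L by have := P rw (- rz); rewrite hL pmulr_rge0.
have xM : `|x| ^+ 2 <= M * H * L.
  have := psd2_cauchy rw (- rz) P M0 HM; rewrite hL => /le_trans; apply.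
  by rewrite -mulrA ler_pM2l// ler_wpM2r.
have K0 : 0 <= K by apply: le_trans KK.
set k := h * rww + hw * rw^*; rewrite -/k in KK.
have Ex : E * (h * `|rw| ^+ 2) = x + rz * k.
  rewrite /E rwz_eq normCK /x /k /Hww.
  have rwJ0 : rw^* != 0 by rewrite conjC_eq0.
  by field; rewrite rwJ0.
have z0 : 0 <= `|rz| ^+ 2 by rewrite exprn_ge0.
(* The parallelogram identity. *)
have xk : `|x + rz * k| ^+ 2 <= 2 * (`|x| ^+ 2 + `|rz * k| ^+ 2).
  rewrite -subr_ge0.
  have -> : 2 * (`|x| ^+ 2 + `|rz * k| ^+ 2) - `|x + rz * k| ^+ 2 = `|x - rz * k| ^+ 2.
    by rewrite !normCK !(rmorphD, rmorphN)/=; ring.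
  by rewrite exprn_ge0.
have EM : `|E| ^+ 2 * m ^+ 2 <= 2 * (M * H + K ^+ 2) * (L + `|rz| ^+ 2).
  apply: (@le_trans _ _ (`|E * (h * `|rw| ^+ 2)| ^+ 2)).
    rewrite normrM exprMn ler_wpM2l ?exprn_ge0//.
    have hh : 0 <= h * `|rw| ^+ 2 by apply/ltW/(lt_le_trans m0).
    by rewrite (ger0_norm hh) lerXn2r// nnegrE// ltW.
  rewrite Ex (le_trans xk)// -mulrA ler_pM2l//.
  have kK : `|rz * k| ^+ 2 <= K ^+ 2 * `|rz| ^+ 2.
    by rewrite normrM exprMn mulrC ler_wpM2r// lerXn2r// nnegrE.
  rewrite (le_trans (lerD xM kK))//.
  have MH : 0 <= M * H by rewrite mulr_ge0 ?ltW// (lt_le_trans h0).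
  have K20 : 0 <= K ^+ 2 by rewrite exprn_ge0.
  by rewrite mulrDl lerD// ler_wpM2l// ?lerDl ?lerDr.
have m20 : 0 < m ^+ 2 by rewrite exprn_gt0.
by rewrite mulrAC ler_pdivlMr.
Qed.

End PositiveForms.

(** * Derivatives along real lines *)

Section WirtingerCalculus.
Context {R : realType} {n : nat}.
Local Notation Cn := 'rV[R[i]]_n.+1.
Implicit Types (f : Cn -> R) (g : Cn -> R[i]) (p q v : Cn) (U : set Cn).

Lemma Im_continuous : continuous (fun z : R[i] => complex.Im z : R).
Proof.
move=> z; apply/(@cvgrPdist_lt _ R _ _ (nbhs_filter z)) => e e0.
have ec : (0 : R[i]) < e%:C%C by rewrite ltcR.
have := @nbhsx_ballx _ R[i] z _ ec.
apply: filterS => t; rewrite -ball_normE /ball_/= normc_def ltcR.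
move=> /(le_lt_trans _); apply.
rewrite -sqrtr_sqr; case: z t => [a b] [c d] /=; rewrite ler_wsqrtr//.
by rewrite lerDr sqr_ge0.
Qed.

(** Continuity of the real lines: it makes [pd] depend on germs only. *)
Lemma near_slice (U : set Cn) (p v : Cn) : nbhs p U ->
  \forall t \near (0 : R), U (p + t%:C%C *: v).
Proof.
move=> Up.
have : (fun t : R => p + t%:C%C *: v) @ (0 : R) --> p.
  rewrite [X in _ --> X](_ : p = p + 0 *: v); last by rewrite scale0r addr0.
  apply: cvgD; first exact: cvg_cst.
  apply: cvgZr_tmp.
  apply/(@cvgrPdist_lt _ (R[i])) => e e0.
  have [e' ee] : exists e', e = e'%:C%C.
    by apply/complex_realP; rewrite realE ltW.
  have : \forall t \near (0:R), `|0 - t| < e'.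
    by apply: nbhsx_ballx; rewrite -ltcR -ee.
  apply: filterS => t; rewrite ee.
  by rewrite !sub0r !normrN normc_def/= expr0n addr0 sqrtr_sqr ltcR.
by move/(_ U Up).
Qed.

Lemma slice0 v f p : slice v f p 0 = f p.
Proof. by rewrite /slice scale0r addr0. Qed.

Definition is_pd v f p (d : R) := is_derive (0 : R) 1 (slice v f p) d.

Lemma is_pdE v f p d : is_pd v f p d -> pd v f p = d.
Proof. by move=> fd; rewrite /pd derive1E; exact: (@derive_val _ _ _ _ _ _ _ fd). Qed.

Lemma is_pdP v f p : pderivable v f p -> is_pd v f p (pd v f p).
Proof. by move=> fd; rewrite /pd derive1E; apply: DeriveDef. Qed.

Lemma is_pd_pderivable v f p d : is_pd v f p d -> pderivable v f p.
Proof. by case. Qed.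

Lemma is_pd_near v f1 f2 p d : (\forall q \near p, f1 q = f2 q) ->
  is_pd v f1 p d -> is_pd v f2 p d.
Proof. by move=> /near_slice /near_eq_is_derive; apply. Qed.

Lemma is_pd_cst v (c : R) p : is_pd v (fun=> c) p 0.
Proof. exact: is_derive_cst. Qed.

Lemma is_pdD v f1 f2 p d1 d2 : is_pd v f1 p d1 -> is_pd v f2 p d2 ->
  is_pd v (fun q => f1 q + f2 q) p (d1 + d2).
Proof. exact: is_deriveD. Qed.

Lemma is_pdN v f p d : is_pd v f p d -> is_pd v (fun q => - f q) p (- d).
Proof. exact: is_deriveN. Qed.

Lemma is_pdM v f1 f2 p d1 d2 : is_pd v f1 p d1 -> is_pd v f2 p d2 ->
  is_pd v (fun q => f1 q * f2 q) p (d1 * f2 p + f1 p * d2).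
Proof.
move=> h1 h2; have := is_deriveM h1 h2; rewrite !slice0.
by rewrite /GRing.scale/= addrC [f2 p * _]mulrC.
Qed.

(** * Wirtinger derivatives *)

Definition is_cpd v g p (D : R[i]) :=
  is_pd v (fun q => complex.Re (g q)) p (complex.Re D) /\
  is_pd v (fun q => complex.Im (g q)) p (complex.Im D).

Lemma is_cpdE v g p D : is_cpd v g p D -> cpd v g p = D.
Proof. by case=> [h1 h2]; rewrite /cpd (is_pdE h1) (is_pdE h2); case: D {h1 h2}. Qed.

Lemma is_cpd_near v g1 g2 p D : (\forall q \near p, g1 q = g2 q) ->
  is_cpd v g1 p D -> is_cpd v g2 p D.
Proof.
by move=> e [h1 h2]; split; [apply: is_pd_near h1|apply: is_pd_near h2];
  apply: filterS e => q ->.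
Qed.

Lemma is_cpd_cst v (c : R[i]) p : is_cpd v (fun=> c) p 0.
Proof. by split; exact: is_pd_cst. Qed.

Lemma is_cpd_toC v f p d : is_pd v f p d -> is_cpd v (toC f) p d%:C%C.
Proof. by move=> fd; split => //=; exact: is_pd_cst. Qed.

Lemma is_cpdD v g1 g2 p D1 D2 : is_cpd v g1 p D1 -> is_cpd v g2 p D2 ->
  is_cpd v (fun q => g1 q + g2 q) p (D1 + D2).
Proof.
move=> [a1 b1] [a2 b2].
have ReD (x y : R[i]) : complex.Re (x + y) = complex.Re x + complex.Re y.
  by case: x y => [? ?] [].
have ImD (x y : R[i]) : complex.Im (x + y) = complex.Im x + complex.Im y.
  by case: x y => [? ?] [].
split; rewrite ?ReD ?ImD.
  by under eq_fun do rewrite ReD; exact: is_pdD.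
by under eq_fun do rewrite ImD; exact: is_pdD.
Qed.

Lemma is_cpdM v g1 g2 p D1 D2 : is_cpd v g1 p D1 -> is_cpd v g2 p D2 ->
  is_cpd v (fun q => g1 q * g2 q) p (D1 * g2 p + g1 p * D2).
Proof.
move=> [a1 b1] [a2 b2].
have ReM (x y : R[i]) : complex.Re (x * y) =
  complex.Re x * complex.Re y - complex.Im x * complex.Im y by case: x y => [? ?] [].
have ImM (x y : R[i]) : complex.Im (x * y) =
  complex.Re x * complex.Im y + complex.Im x * complex.Re y by case: x y => [? ?] [].
split.
  under eq_fun do rewrite ReM.
  have := is_pdD (is_pdM a1 a2) (is_pdN (is_pdM b1 b2)).
  congr is_pd.
  by case: D1 D2 (g1 p) (g2 p) {a1 b1 a2 b2} => [? ?] [? ?] [? ?] [? ?] /=; ring.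
under eq_fun do rewrite ImM.
have := is_pdD (is_pdM a1 b2) (is_pdM b1 a2).
congr is_pd.
by case: D1 D2 (g1 p) (g2 p) {a1 b1 a2 b2} => [? ?] [? ?] [? ?] [? ?] /=; ring.
Qed.

Lemma is_cpd_conj v g p D : is_cpd v g p D ->
  is_cpd v (fun q => (g q)^*) p D^*.
Proof.
have ReJ (x : R[i]) : complex.Re x^* = complex.Re x by case: x.
have ImJ (x : R[i]) : complex.Im x^* = - complex.Im x by case: x.
move=> [h1 h2]; split; rewrite ?ReJ ?ImJ.
  by under eq_fun do rewrite ReJ.
by under eq_fun do rewrite ImJ; exact: is_pdN.
Qed.

(** The two Wirtinger derivatives are carried together: conjugation exchanges
    them, and the rules for both follow from those for the partial
    derivatives. *)
Definition is_wirtinger a g p (D Db : R[i]) := exists Dx Dy,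
  [/\ is_cpd (xdir a) g p Dx, is_cpd (ydir a) g p Dy,
      D = (Dx - 'i%C * Dy) / 2 & Db = (Dx + 'i%C * Dy) / 2].

Lemma is_wirtinger_dz a g p D Db : is_wirtinger a g p D Db -> dz a g p = D.
Proof. by case=> [Dx [Dy [/is_cpdE h1 /is_cpdE h2 -> _]]]; rewrite /dz h1 h2. Qed.

Lemma is_wirtinger_dzb a g p D Db : is_wirtinger a g p D Db -> dzb a g p = Db.
Proof. by case=> [Dx [Dy [/is_cpdE h1 /is_cpdE h2 _ ->]]]; rewrite /dzb h1 h2. Qed.

Lemma is_wirtinger_near a g1 g2 p D Db : (\forall q \near p, g1 q = g2 q) ->
  is_wirtinger a g1 p D Db -> is_wirtinger a g2 p D Db.
Proof.
move=> e [Dx [Dy [h1 h2 h3 h4]]]; exists Dx, Dy; split => //.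
  exact: is_cpd_near h1.
exact: is_cpd_near h2.
Qed.

Lemma is_wirtingerD a g1 g2 p D1 E1 D2 E2 :
  is_wirtinger a g1 p D1 E1 -> is_wirtinger a g2 p D2 E2 ->
  is_wirtinger a (fun q => g1 q + g2 q) p (D1 + D2) (E1 + E2).
Proof.
move=> [Dx1 [Dy1 [x1 y1 -> ->]]] [Dx2 [Dy2 [x2 y2 -> ->]]].
by exists (Dx1 + Dx2), (Dy1 + Dy2); split; [exact: is_cpdD|exact: is_cpdD|ring|ring].
Qed.

Lemma is_wirtingerM a g1 g2 p D1 E1 D2 E2 :
  is_wirtinger a g1 p D1 E1 -> is_wirtinger a g2 p D2 E2 ->
  is_wirtinger a (fun q => g1 q * g2 q) p
    (D1 * g2 p + g1 p * D2) (E1 * g2 p + g1 p * E2).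
Proof.
move=> [Dx1 [Dy1 [x1 y1 -> ->]]] [Dx2 [Dy2 [x2 y2 -> ->]]].
by eexists; eexists; split; [exact: is_cpdM x1 x2|exact: is_cpdM y1 y2|ring|ring].
Qed.

Lemma conj_imag : ('i%C : R[i])^* = - 'i%C.
Proof. by rewrite /Num.conj/= /conjc; simpc. Qed.

Lemma conj_half : (2^-1 : R[i])^* = 2^-1.
Proof. by rewrite fmorphV rmorph_nat. Qed.

Lemma conj_dz (x y : R) :
  (x%:C%C + 'i%C * y%:C%C) / 2 = ((x%:C%C - 'i%C * y%:C%C) / 2)^* :> R[i].
Proof.
have rJ (z : R) : (z%:C%C : R[i])^* = z%:C%C := conjc_real z.
by rewrite rmorphM/= conj_half rmorphB rmorphM/= conj_imag !rJ; ring.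
Qed.

Lemma is_wirtinger_conj a g p D Db : is_wirtinger a g p D Db ->
  is_wirtinger a (fun q => (g q)^*) p Db^* D^*.
Proof.
move=> [Dx [Dy [x y -> ->]]]; exists Dx^*, Dy^*; split.
- exact: is_cpd_conj.
- exact: is_cpd_conj.
- by rewrite rmorphM/= conj_half rmorphD rmorphM/= conj_imag; ring.
- by rewrite rmorphM/= conj_half rmorphB rmorphM/= conj_imag; ring.
Qed.


(** * Regularity classes *)

Lemma near_eq_continuous f1 f2 p : (\forall q \near p, f1 q = f2 q) ->
  {for p, continuous f1} -> {for p, continuous f2}.
Proof.
move=> e c; change (f2 q @[q --> p] --> f2 p).
rewrite -(nbhs_singleton e).
apply: cvg_trans c; exact: (@near_eq_cvg _ _ _ (nbhs_filter p)).
Qed.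

Lemma Ck_on_eq k U f1 f2 : open U -> (forall q, U q -> f1 q = f2 q) ->
  Ck_on k U f1 -> Ck_on k U f2.
Proof.
move=> oU; elim: k f1 f2 => [|k IH] f1 f2 f12 /= [c1 h1].
  split=> // p Up; apply: near_eq_continuous (c1 p Up).
  by apply: filterS (open_nbhs_nbhs (conj oU Up)).
have near12 p : U p -> \forall q \near p, f1 q = f2 q.
  by move=> Up; apply: filterS (open_nbhs_nbhs (conj oU Up)).
split; first by move=> p Up; apply: near_eq_continuous (near12 p Up) (c1 p Up).
move=> a v /h1 [d1 ck]; split.
  by move=> p Up; apply/is_pd_pderivable/(is_pd_near (near12 _ Up))/is_pdP/d1.
apply: IH ck => p Up; apply/esym/is_pdE.
exact: is_pd_near (near12 _ Up) (is_pdP (d1 _ Up)).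
Qed.

Lemma Ck_onD k U f1 f2 : open U -> Ck_on k U f1 -> Ck_on k U f2 ->
  Ck_on k U (fun q => f1 q + f2 q).
Proof.
move=> oU; elim: k f1 f2 => [|k IH] f1 f2 /= [c1 h1] [c2 h2]; split => //.
- by move=> p Up; exact: (cvgD (c1 p Up) (c2 p Up)).
- by move=> p Up; exact: (cvgD (c1 p Up) (c2 p Up)).
move=> a v av; have [d1 k1] := h1 _ _ av; have [d2 k2] := h2 _ _ av.
have D p : U p -> is_pd v (fun q => f1 q + f2 q) p (pd v f1 p + pd v f2 p).
  by move=> Up; apply: is_pdD; apply: is_pdP; [exact: d1|exact: d2].
split; first by move=> p /D /is_pd_pderivable.
by apply: Ck_on_eq (IH _ _ k1 k2) => // p /D /is_pdE.
Qed.

Lemma Ck_on_cst k U (c : R) : Ck_on k U (fun=> c).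
Proof.
elim: k c => [|k IH] c /=; split => //.
- by move=> p _; exact: cst_continuous.
- by move=> p _; exact: cst_continuous.
move=> a v _; split; first by move=> p _; exact/is_pd_pderivable/is_pd_cst.
have -> : pd v (fun _ : Cn => c) = fun=> 0.
  by apply/funext => p; exact/is_pdE/is_pd_cst.
exact: IH.
Qed.

Lemma is_pd_Im_coord v a p :
  is_pd v (fun q => complex.Im (q 0 a)) p (complex.Im (v 0 a)).
Proof.
rewrite /is_pd.
have -> : slice v (fun q => complex.Im (q 0 a)) p =
    (fun t : R => complex.Im (p 0 a) + t * complex.Im (v 0 a)).
  apply/funext => t; rewrite /slice !mxE; case: (p 0 a) (v 0 a) => [? y] [? z] /=.
  by rewrite mul0r addr0.
have h := is_deriveD (is_derive_cst (complex.Im (p 0 a)) (0 : R) 1)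
  (is_deriveM (is_derive_id (0 : R) 1)
     (is_derive_cst (complex.Im (v 0 a)) (0 : R) 1)).
by apply: is_derive_eq h _; rewrite /GRing.scale/= mulr0 !add0r mulr1.
Qed.

(** The partial derivatives of a real linear form are constant. *)
Lemma Ck_on_Im_coord k U a : Ck_on k U (fun q => complex.Im (q 0 a)).
Proof.
have cont p : {for p, continuous (fun q : Cn => complex.Im (q 0 a))}.
  apply: (@continuous_comp _ _ _ (fun M : Cn => M 0 a)).
    exact: coord_continuous.
  exact: Im_continuous.
case: k => [|k] /=; split => // b v _; split.
  by move=> p _; apply/is_pd_pderivable/is_pd_Im_coord.
have -> : pd v (fun q : Cn => complex.Im (q 0 a)) = fun=> complex.Im (v 0 a).
  by apply/funext => p; exact/is_pdE/is_pd_Im_coord.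
exact: Ck_on_cst.
Qed.

(** * Second derivatives and the complex Hessian *)

Lemma cpd_toC v f p : cpd v (toC f) p = (pd v f p)%:C%C.
Proof. by rewrite /cpd /toC (is_pdE (is_pd_cst v 0 p)). Qed.

Lemma normr_dz_sqr (x y : R) :
  ((x / 2) ^+ 2 + (y / 2) ^+ 2)%:C%C = `|(x%:C%C - 'i%C * y%:C%C) / 2| ^+ 2 :> R[i].
Proof.
have -> : (2^-1 : R[i]) = (2^-1)%:C%C by rewrite fmorphV rmorph_nat.
rewrite -add_Re2_Im2; congr (_%:C%C); simpc; rewrite /=.
by rewrite sqrrN.
Qed.

Lemma dz_toC a f : dz a (toC f) =
  (fun p => ((pd (xdir a) f p)%:C%C - 'i%C * (pd (ydir a) f p)%:C%C) / 2).
Proof. by apply/funext => p; rewrite /dz !cpd_toC. Qed.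

(** As f is real, its two Wirtinger derivatives are conjugate everywhere, even
    where the partial derivatives are mere conventional values. *)
Lemma dzb_toC a f : dzb a (toC f) = (fun p => (dz a (toC f) p)^*).
Proof.
apply/funext => p; rewrite dz_toC /dzb !cpd_toC.
by move: (pd _ _ _) (pd _ _ _) => x y; exact: conj_dz.
Qed.

Lemma Ck_on_continuous k U f p : Ck_on k U f -> U p -> {for p, continuous f}.
Proof. by case: k => [|k] [h _]; exact: h. Qed.

Lemma Ck_on_dz k U f p a : Ck_on k.+1 U f -> U p ->
  is_wirtinger a (toC f) p (dz a (toC f) p) (dz a (toC f) p)^*.
Proof.
move=> [_ H] Up; have [/(_ p Up) dx _] := H a _ (or_introl erefl).
have [/(_ p Up) dy _] := H a _ (or_intror erefl).
move: dx dy => /is_pdP/is_cpd_toC dx /is_pdP/is_cpd_toC dy.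
rewrite dz_toC; eexists; eexists; split; [exact: dx|exact: dy|by []|].
by move: (pd _ _ _) (pd _ _ _) => x y; rewrite conj_dz.
Qed.

(** This expression by derivatives of the partial derivatives of f shows that
    the second derivatives are locally bounded. *)
Lemma Ck_on_dzdz_explicit k U f p a b : Ck_on k.+2 U f -> U p ->
  is_wirtinger b (dz a (toC f)) p
    ((dz b (toC (pd (xdir a) f)) p - 'i%C * dz b (toC (pd (ydir a) f)) p) / 2)
    (((dz b (toC (pd (xdir a) f)) p)^*
      - 'i%C * (dz b (toC (pd (ydir a) f)) p)^*) / 2).
Proof.
move=> [_ H] Up.
have h u : u = xdir a \/ u = ydir a ->
    is_wirtinger b (toC (pd u f)) p
      (dz b (toC (pd u f)) p) (dz b (toC (pd u f)) p)^*.
  by move=> ua; have [_ C1] := H _ _ ua; exact: Ck_on_dz C1 Up.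
have c (z : R[i]) : is_wirtinger b (fun=> z) p 0 0.
  by exists 0, 0; split; rewrite ?(mulr0, addr0, subr0, mul0r)//; exact: is_cpd_cst.
have := is_wirtingerM (is_wirtingerD (h _ (or_introl erefl))
  (is_wirtingerM (c (- 'i%C)) (h _ (or_intror erefl)))) (c 2^-1).
have -> : (fun q => (toC (pd (xdir a) f) q + - 'i%C * toC (pd (ydir a) f) q) / 2)
    = dz a (toC f) by rewrite dz_toC; apply/funext => q; rewrite mulNr.
by rewrite !(mul0r, mulr0, add0r, addr0) !mulNr.
Qed.

Lemma Ck_on_dzdz k U f p a b : Ck_on k.+2 U f -> U p ->
  is_wirtinger b (dz a (toC f)) p
    (dz b (dz a (toC f)) p) (complex_hessian f p a b).
Proof.
move=> C2 Up; have w := Ck_on_dzdz_explicit a b C2 Up.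
by rewrite mxE (is_wirtinger_dz w) (is_wirtinger_dzb w).
Qed.

(** Conjugation exchanges the two kinds of derivatives but keeps the order in
    which they are taken, so it brings this derivative to an entry of the
    Hessian. *)
Lemma dz_dzb k U f p a b : Ck_on k.+2 U f -> U p ->
  dz a (dzb b (toC f)) p = (complex_hessian f p b a)^*.
Proof.
move=> C2 Up; have w := is_wirtinger_conj (Ck_on_dzdz b a C2 Up).
by rewrite dzb_toC (is_wirtinger_dz w).
Qed.

Lemma complex_hessianM k1 k2 U1 U2 f1 f2 p a b :
    open U1 -> open U2 -> Ck_on k1.+2 U1 f1 -> Ck_on k2.+2 U2 f2 -> U1 p -> U2 p ->
  complex_hessian (fun q => f1 q * f2 q) p a b =
    complex_hessian f1 p a b * toC f2 p
    + dz a (toC f1) p * (dz b (toC f2) p)^*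
    + (dz b (toC f1) p)^* * dz a (toC f2) p
    + toC f1 p * complex_hessian f2 p a b.
Proof.
move=> o1 o2 C1 C2 U1p U2p.
have dzM : \forall q \near p,
    dz a (toC f1) q * toC f2 q + toC f1 q * dz a (toC f2) q =
    dz a (toC (fun q => f1 q * f2 q)) q.
  have : \forall q \near p, (U1 `&` U2) q.
    by apply: open_nbhs_nbhs; split; [exact: openI|].
  apply: filterS => q [U1q U2q]; apply/esym.
  have w := is_wirtingerM (Ck_on_dz a C1 U1q) (Ck_on_dz a C2 U2q).
  have e : (fun q => toC f1 q * toC f2 q) = toC (fun q => f1 q * f2 q).
    by apply/funext => q'; rewrite /toC -rmorphM.
  by rewrite e in w; rewrite (is_wirtinger_dz w).
have w := is_wirtingerD
  (is_wirtingerM (Ck_on_dzdz a b C1 U1p) (Ck_on_dz b C2 U2p))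
  (is_wirtingerM (Ck_on_dz b C1 U1p) (Ck_on_dzdz a b C2 U2p)).
have {}w := is_wirtinger_near dzM w.
rewrite [LHS]mxE.
rewrite (is_wirtinger_dzb w).
exact: addrA.
Qed.

(** * Bounds near the origin *)

Definition locally_bounded g :=
  exists M : R, \forall p \near (0 : Cn), `|g p| <= M%:C%C.

Lemma locally_bounded_near g1 g2 : (\forall p \near (0 : Cn), g1 p = g2 p) ->
  locally_bounded g1 -> locally_bounded g2.
Proof. by move=> e [M h]; exists M; apply: filterS2 e h => p ->. Qed.

Lemma locally_bounded_cst (c : R[i]) : locally_bounded (fun=> c).
Proof.
have [M e] : exists M, `|c| = M%:C%C by apply/complex_realP/normr_real.
by exists M; near=> p; rewrite e.
Unshelve. all: end_near.
Qed.

Lemma locally_boundedD g1 g2 : locally_bounded g1 -> locally_bounded g2 ->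
  locally_bounded (fun p => g1 p + g2 p).
Proof.
move=> [M1 h1] [M2 h2]; exists (M1 + M2); apply: filterS2 h1 h2 => p h1 h2.
by rewrite rmorphD/= (le_trans (ler_normD _ _))// lerD.
Qed.

Lemma locally_boundedM g1 g2 : locally_bounded g1 -> locally_bounded g2 ->
  locally_bounded (fun p => g1 p * g2 p).
Proof.
move=> [M1 h1] [M2 h2]; exists (M1 * M2); apply: filterS2 h1 h2 => p h1 h2.
by rewrite rmorphM/= normrM ler_pM.
Qed.

Lemma locally_bounded_conj g : locally_bounded g ->
  locally_bounded (fun p => (g p)^*).
Proof. by move=> [M h]; exists M; apply: filterS h => p; rewrite norm_conjC. Qed.

Lemma locally_bounded_toC f : {for 0, continuous f} -> locally_bounded (toC f).
Proof.
move=> /(@cvgrPdist_lt _ R _ _ (nbhs_filter (0 : Cn))) /(_ 1 ltr01) h.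
exists (`|f 0| + 1); apply: filterS h => p h.
rewrite /toC normc_def/= expr0n addr0 sqrtr_sqr lecR -lerBlDl.
by rewrite (le_trans (lerB_dist _ _))// distrC ltW.
Qed.

Lemma locally_bounded_dz k U f a : Ck_on k.+1 U f -> U 0 ->
  locally_bounded (dz a (toC f)).
Proof.
move=> [_ H] U0; rewrite dz_toC.
have h v : v = xdir a \/ v = ydir a -> locally_bounded (toC (pd v f)).
  move=> va; apply: locally_bounded_toC; have [_ Ck] := H _ _ va.
  exact: Ck_on_continuous Ck U0.
under eq_fun do rewrite -mulNr.
apply: locally_boundedM; last exact: locally_bounded_cst.
apply: locally_boundedD; first exact: h (or_introl erefl).
apply: locally_boundedM; first exact: locally_bounded_cst.
exact: h (or_intror erefl).
Qed.

Lemma locally_bounded_hessian k U f a b : open U -> Ck_on k.+2 U f -> U 0 ->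
  locally_bounded (fun p => complex_hessian f p a b).
Proof.
move=> oU C2 U0.
apply: (@locally_bounded_near (fun p => ((dz b (toC (pd (xdir a) f)) p)^*
      - 'i%C * (dz b (toC (pd (ydir a) f)) p)^*) / 2)).
  apply: filterS (open_nbhs_nbhs (conj oU U0)) => p Up; rewrite mxE; apply/esym.
  exact: is_wirtinger_dzb (Ck_on_dzdz_explicit a b C2 Up).
have h v : v = xdir a \/ v = ydir a ->
    locally_bounded (fun p => (dz b (toC (pd v f)) p)^*).
  case: C2 => _ H va; apply: locally_bounded_conj; have [_ Ck] := H _ _ va.
  exact: locally_bounded_dz Ck U0.
under eq_fun do rewrite -mulNr.
apply: locally_boundedM; last exact: locally_bounded_cst.
apply: locally_boundedD; first exact: h (or_introl erefl).
apply: locally_boundedM; first exact: locally_bounded_cst.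
exact: h (or_intror erefl).
Qed.

End WirtingerCalculus.

(** * Defining functions on the boundary *)

Section Geometry.
Context {R : realType} {n : nat}.
Local Notation Cn := 'rV[R[i]]_n.+1.
Implicit Types (r h : Cn -> R) (p : Cn).

Lemma sqr_half_gt (y : R) :
  1 / 2 < y -> 4^-1 ^+ 2 < (y / 2) ^+ 2.
Proof. by move=> y1; nra. Qed.

Lemma boundary_eq0 r p : {for p, continuous r} ->
  boundary [set q | r q < 0] p -> r p = 0.
Proof.
move=> c [cl ni]; apply/eqP; rewrite eq_le; apply/andP; split.
  rewrite leNgt; apply/negP => rp.
  have : nbhs p [set q | 0 < r q] by exact: (@cvgr_gt R _ _ (nbhs_filter p) r _ c 0 rp).
  by move=> /cl [q [/= /ltW]]; rewrite leNgt => /negP.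
rewrite leNgt; apply/negP => rp; apply: ni.
exact: (@cvgr_lt R _ _ (nbhs_filter p) r _ c 0 rp).
Qed.

(** If h were negative at 0, then r h would be positive at the points of
    {r < 0} that accumulate at the boundary point 0. *)
Lemma factor_gt0 (V : set Cn) r h :
  {for 0, continuous h} -> h 0 != 0 -> open V -> V 0 ->
  boundary [set q | r q < 0] 0 ->
  [set q | r q < 0] `&` V = [set q | r q * h q < 0] `&` V -> 0 < h 0.
Proof.
move=> c h0 oV V0 [cl _] E; rewrite lt_def h0 leNgt; apply/negP => hn.
have : nbhs (0 : Cn) ([set q | h q < 0] `&` V).
  apply: filterI; last exact: open_nbhs_nbhs.
  exact: (@cvgr_lt R _ _ (nbhs_filter (0 : Cn)) h _ c 0 hn).
move=> /cl [q [/= rq [hq Vq]]].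
have [/= +] : ([set q | r q * h q < 0] `&` V) q by rewrite -E.
by rewrite nmulr_rlt0// ltNge ltW.
Qed.

Lemma positive_semidefinite_psd2 (H : 'M[R[i]]_n.+1) i j : i != j ->
  positive_semidefinite H -> psd2 (H i i) (H i j) (H j i) (H j j).
Proof.
move=> ij P s t; have := P (s *: delta_mx 0 i + t *: delta_mx 0 j).
set v := (_ + _ : Cn).
have vi : v 0 i = s by rewrite !mxE !eqxx (negbTE ij) mulr1 mulr0 addr0.
have vj : v 0 j = t.
  by rewrite !mxE !eqxx eq_sym (negbTE ij) mulr1 mulr0 add0r.
have vk k : k != i -> k != j -> v 0 k = 0.
  by move=> /negbTE ki /negbTE kj; rewrite !mxE ki kj !andbF !mulr0 addr0.
have red (f : 'I_n.+1 -> R[i]) :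
    (forall k, k != i -> k != j -> f k = 0) -> \sum_k f k = f i + f j.
  move=> f0; rewrite (bigD1 i)//= (bigD1 j)/= 1?eq_sym// big1 ?addr0// => k.
  by move=> /andP[]; exact: f0.
rewrite red; last first.
  by move=> k ki kj; rewrite big1// => b _; rewrite vk// mulr0 mul0r.
rewrite !red; last 2 first.
- by move=> k ki kj; rewrite (vk k)// rmorph0 mulr0.
- by move=> k ki kj; rewrite (vk k)// rmorph0 mulr0.
by rewrite vi vj; congr (0 <= _); rewrite -!mulrA !addrA.
Qed.

End Geometry.
Theorem proposition6p3 (R : realType) (n : nat)
    (Omega : set 'rV[R[i]]_n.+1) (r F h : 'rV[R[i]]_n.+1 -> R)
    (F_smooth : smooth_near0 F)
    (F_order : order_ge2_at0 F)
    (rE : forall p, r p = complex.Im (p 0 (widx n)) + F p)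
    (OmegaE : Omega = [set p | r p < 0])
    (Omega0 : boundary Omega 0)
    (h_smooth : smooth_near0 h)
    (h_neq0 : \forall p \near (0 : 'rV[R[i]]_n.+1), h p != 0)
    (rho_psh : local_psh_defining_function_on_boundary Omega
                 (fun p => r p * h p)) :
  forall j : 'I_n,
    exists (E : 'rV[R[i]]_n.+1 -> R[i]) (C : R),
      0 < C /\
      \forall p \near (0 : 'rV[R[i]]_n.+1), boundary Omega p ->
        dzlog (zidx j) (toC h) p
          = - dzlog (zidx j) (dzb (widx n) (toC r)) p + E p /\
        `|E p| ^+ 2
          <= C%:C%C * (levi r j p + `|dz (zidx j) (toC r) p| ^+ 2).
Proof.
move=> j.
have [UF [oUF UF0 F_Ck]] := F_smooth; have [Uh [oUh Uh0 h_Ck]] := h_smooth.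
have [V [[oV V0] _ VE _ psd]] := rho_psh.
have r_Ck k : Ck_on k UF r.
  rewrite (_ : r = fun p => complex.Im (p 0 (widx n)) + F p); last exact/funext.
  by apply: Ck_onD => //; exact: Ck_on_Im_coord.
have nearUF := open_nbhs_nbhs (conj oUF UF0).
have nearUh := open_nbhs_nbhs (conj oUh Uh0).
have nearV := open_nbhs_nbhs (conj oV V0).
rewrite OmegaE in Omega0 VE psd *.
have h_cont0 := Ck_on_continuous (h_Ck 0%N) Uh0.
have h0_gt0 : 0 < h 0.
  exact: factor_gt0 h_cont0 (nbhs_singleton h_neq0) oV V0 Omega0 VE.
have h_gt : \forall p \near (0 : 'rV[R[i]]_n.+1), h 0 / 2 < h p.
  apply: (@cvgr_gt R _ _ (nbhs_filter (0 : 'rV[R[i]]_n.+1)) h _ h_cont0).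
  by rewrite gtr_pMr// invf_lt1// ltr1n.
pose z := zidx j; pose w := widx n.
have zw : z != w by rewrite eq_sym neq_lift.
have ry0 : pd (ydir w) r 0 = 1.
  have [_ /(_ w (ydir w) (or_intror erefl)) [dF _]] := F_Ck 1%N.
  have := is_pdD (is_pd_Im_coord (ydir w) w 0) (is_pdP (dF _ UF0)).
  have [_ /(_ w) [_ ->]] := F_order.
  rewrite !mxE !eqxx mulr1 addr0 => /is_pdE e; apply: etrans e.
  by congr pd; apply/funext.
have ry_gt : \forall p \near (0 : 'rV[R[i]]_n.+1), 1 / 2 < pd (ydir w) r p.
  have [_ /(_ w (ydir w) (or_intror erefl)) [_ C1]] := r_Ck 2%N.
  have c := @Ck_on_continuous _ _ 1 _ _ _ C1 UF0.
  apply: (@cvgr_gt R _ _ (nbhs_filter (0 : 'rV[R[i]]_n.+1)) _ _ c).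
  by rewrite ry0 ltr_pdivrMr// mul1r ltr1n.
have h_bd : locally_bounded (toC h) by exact: locally_bounded_toC.
have [H hH] := h_bd.
have rz_bd a := locally_bounded_dz a (r_Ck 2%N) UF0.
have hz_bd a := locally_bounded_dz a (h_Ck 2%N) Uh0.
have rww_bd := locally_bounded_hessian w w oUF (r_Ck 2%N) UF0.
(* A bound of the K of the pointwise estimate, then one of the (w, w) entry
   of the Hessian of r h. *)
have [K hK] : locally_bounded (fun p => toC h p * complex_hessian r p w w
    + dz w (toC h) p * (dz w (toC r) p)^*).
  by apply: locally_boundedD; apply: locally_boundedM => //; exact: locally_bounded_conj.
have [M hM] : locally_bounded (fun p => toC h p * complex_hessian r p w w
    + dz w (toC r) p * (dz w (toC h) p)^* + dz w (toC h) p * (dz w (toC r) p)^*).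
  by do 2?[apply: locally_boundedD]; apply: locally_boundedM => //;
    exact: locally_bounded_conj.
(* The pointwise estimate takes positive bounds M' and H'. Its m comes from
   h > h 0 / 2 and |r_w| >= |r_y| / 2 > 1 / 4, with w = x + i y, near 0. *)
pose M' := `|M| + 1; pose H' := `|H| + 1; pose m := h 0 / 2 / 16.
have M'0 : 0 < M' by rewrite ltr_wpDl.
have H'0 : 0 < H' by rewrite ltr_wpDl.
have m0 : 0 < m by rewrite !divr_gt0.
exists (fun p => dzlog z (toC h) p + dzlog z (dzb w (toC r)) p).
exists (2 * (M' * H' + K ^+ 2) / m ^+ 2).
split.
  by rewrite divr_gt0 ?exprn_gt0// mulr_gt0// ltr_wpDr ?sqr_ge0 ?mulr_gt0.
have hess p a b : UF p -> Uh p -> r p = 0 ->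
    complex_hessian (fun q => r q * h q) p a b =
    toC h p * complex_hessian r p a b + dz a (toC r) p * (dz b (toC h) p)^*
    + dz a (toC h) p * (dz b (toC r) p)^*.
  move=> UFp Uhp rp0.
  have alg (x A B D G Z W : R[i]) : Z = 0 ->
      A * x + B + D * G + Z * W = x * A + B + G * D by move=> ->; ring.
  apply: etrans (complex_hessianM a b oUF oUh (r_Ck 2%N) (h_Ck 2%N) UFp Uhp) _.
  by apply: alg; rewrite /toC rp0.
near=> p => bp.
have UFp : UF p by near: p.
have Uhp : Uh p by near: p.
have Vp : V p by near: p.
split; first by rewrite addrCA addNr addr0.
have rp0 : r p = 0 by apply: boundary_eq0 bp; exact: Ck_on_continuous (r_Ck 0%N) UFp.
have P := psd2_eq (hess p z z UFp Uhp rp0) (hess p z w UFp Uhp rp0)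
  (hess p w z UFp Uhp rp0) (hess p w w UFp Uhp rp0)
  (positive_semidefinite_psd2 zw (psd p (conj bp Vp))).
have hp : h 0 / 2 < h p by near: p.
have hp0 : 0 < h p by apply: lt_trans hp; rewrite divr_gt0.
have hJ : dzlog z (toC h) p + dzlog z (dzb w (toC r)) p =
    dz z (toC h) p / toC h p + (complex_hessian r p w z)^* / (dz w (toC r) p)^*.
  by rewrite /dzlog (dz_dzb z w (r_Ck 2%N) UFp) dzb_toC.
have leviE : levi r j p =
    complex_hessian r p z z * `|dz w (toC r) p| ^+ 2
    + complex_hessian r p w w * `|dz z (toC r) p| ^+ 2
    - 2 * 'Re (complex_hessian r p z w * dz w (toC r) p * (dz z (toC r) p)^*).
  by rewrite /levi (dzb_toC z) !mxE.
have rw_ge : m%:C%C <= toC h p * `|dz w (toC r) p| ^+ 2.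
  apply: (@le_trans _ _ (h p * (pd (ydir w) r p / 2) ^+ 2)%:C%C).
    have -> : m = h 0 / 2 * (4^-1) ^+ 2 by rewrite /m; field.
    have ryp : 1 / 2 < pd (ydir w) r p by near: p.
    have hp' := ltW hp; move: hp' ryp; move: (pd _ _ _) => y hp' ryp.
    rewrite lecR ler_pM// ?divr_ge0 ?ltW ?sqr_ge0//.
    exact: sqr_half_gt.
  rewrite rmorphM/= ler_pM2l ?ltcR//.
  rewrite dz_toC; move: (pd _ _ _) (pd _ _ _) => x y.
  by rewrite -normr_dz_sqr lecR lerDr sqr_ge0.
rewrite hJ leviE.
have -> : (2 * (M' * H' + K ^+ 2) / m ^+ 2)%:C%C =
    2 * (M'%:C%C * H'%:C%C + K%:C%C ^+ 2) / m%:C%C ^+ 2 :> R[i].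
  by rewrite !(rmorphM, rmorphD, fmorphV, rmorphXn, rmorph_nat)/=.
have le_shift (x : R[i]) (k : R) :
    0 <= x -> `|x| <= k%:C%C -> x <= (`|k| + 1)%:C%C.
  move=> x0; rewrite ger0_norm// => /le_trans; apply.
  by rewrite lecR ler_wpDr// ler_norm.
have [_ Hww0 _] := psd2_hermitian P.
apply: (conj_log_derivative_bound _ _ _ _ _ _ _ P).
- by rewrite ltcR.
- by apply: le_shift; [rewrite lecR ltW|near: p].
- by rewrite ltcR.
- by apply: le_shift => //; near: p.
- by near: p.
- by rewrite ltcR.
- exact: rw_ge.
Unshelve. all: end_near.
Qed.
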